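(* Let $q$ be a prime power with $q\notin\{2,4\}$. Then the power graph of $\mathrm{SL}_3(q)$ contains an induced cycle of length greater than $3$. Furthermore, such a cycle can be chosen not to contain scalar matrices.
   Context: The power graph of a group $G$ is the simple graph with vertex set $G$ in which two distinct elements $x,y$ are joined by an edge if and only if $x^m=y$ or $y^m=x$ for some $m\in\mathbb{N}$. The length of a cycle is the number of its vertices. *)

(* Defs.v *)
From HB Require Import structures.
From mathcomp Require Import all_boot all_order all_algebra all_fingroup.

Set Implicit Arguments.
Unset Strict Implicit.
Unset Printing Implicit Defensive.

Import GRing.Theory.

Record sgraph := SGraph {
  vertex :> Type;
  adj : vertex -> vertex -> Prop;
  adj_sym : forall x y, adj x y -> adj y x;
  adj_irrefl : forall x, ~ adj x x
}.

(* [ordS] is the cyclic successor [i |-> i + 1 mod n], so the right-hand side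
   is the edge relation of the cycle graph on ['I_n]. *)
Definition induced_cycle (X : sgraph) (n : nat) (c : 'I_n -> X) : Prop :=
  [/\ 2 < n, injective c
    & forall i j : 'I_n, adj (c i) (c j) <-> (j = ordS i \/ i = ordS j)].

Section PowerGraph.
Variable gT : finGroupType.

(* Allowing the exponent [m = 0] changes nothing: in a finite group [1] is
   also a positive power of every element. *)
Definition power_adj (x y : gT) : Prop :=
  x <> y /\ exists m : nat, (x ^+ m)%g = y \/ (y ^+ m)%g = x.

Lemma power_adj_sym x y : power_adj x y -> power_adj y x.
Proof. by case=> /nesym neq_yx [m /or_comm xy]; split=> //; exists m. Qed.

Lemma power_adj_irrefl x : ~ power_adj x x.
Proof. by case. Qed.

Definition power_graph : sgraph := SGraph power_adj_sym power_adj_irrefl.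

End PowerGraph.

Section SpecialLinear.
Variables (n : nat) (F : finFieldType).

Definition SL_set := [set g : {'GL_n[F]} | (\det (GLval g) == 1)%R].

Fact SL_group_set : group_set SL_set.
Proof.
apply/group_setP; split=> [|x y]; first by rewrite inE GL_1E det1.
by rewrite !inE GL_ME det_mulmx => /eqP-> /eqP->; rewrite mul1r.
Qed.

Definition SL : {group {'GL_n[F]}} := Group SL_group_set.

End SpecialLinear.

(* For [1 <= n]: [GLval] lands in matrices of size [n.-1.+1]. *)
Definition SL_mx n (F : finFieldType) (g : subg_of (SL n F)) : 'M[F]_n.-1.+1 :=
  GLval (sgval g).

Definition prime_power (q : nat) : Prop :=
  exists p k : nat, [/\ prime p, 0 < k & q = p ^ k].

(* Main.v *)
Require Import Defs.
From mathcomp Require Import all_boot all_order all_algebra all_fingroup.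
From mathcomp Require Import all_solvable all_field.
From mathcomp Require Import zify ring.

Set Implicit Arguments.
Unset Strict Implicit.
Unset Printing Implicit Defensive.

Import GRing.Theory.

(** Suppose that d_0, ..., d_(n-1), with n > 3, are elements of a finite group
    such that d_i and d_j commute exactly when i and j are equal or neighbours
    modulo n, and that neighbours have coprime orders.  Put a vertex
    d_i * d_(i+1) between d_i and d_(i+1).  Both d_i and d_(i+1) are powers of
    this product, so the 2n elements form a closed walk in the power graph.
    There are no chords: adjacent elements of the power graph commute, whatever
    commutes with a product d_i * d_(i+1) commutes with both factors, and the
    commuting pattern of the d_i contains no clique other than the edges.  Only
    the pairs d_i, d_(i+1) themselves remain, and neither of two nontrivial
    elements of coprime orders is a power of the other.  This is
    [subdivision_induced_cycle].

    In SL_3(F) such a hexagon (n = 6) comes from the projective plane.  Let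
    P_0, P_1, P_2 be the triangle of reference, L_i the side opposite to P_i,
    W = (1 : 1 : 1), and H_i the line through P_i and W.  Take a transvection
    u_i with centre P_i and axis H_i, and a homology s_j with centre W and axis
    L_j, acting as a on the plane of L_j and as a^-2 on the line of W.  Since W
    lies on every H_i, and P_i lies on L_j exactly when i <> j, the
    elements u_i and s_j commute exactly when i <> j; two distinct u's do not
    commute, nor do two distinct s's.  Hence u_0, s_1, u_2, s_0, u_1, s_2 is a
    hexagon as required: [commute_hexagon].  The order of u_i divides the
    characteristic p, that of s_j divides q - 1, and these are coprime.

    The construction needs s_j to be nonscalar, that is a^3 <> 1.  The
    multiplicative group is cyclic of order q - 1, so such an a exists unless
    q - 1 divides 3, which means q = 2 or q = 4.  Finally no vertex of the
    resulting 12-cycle is central in SL_3(F), so none is scalar. *)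

(** * Commuting elements of coprime orders *)

Section CoprimeFactors.
Variable gT : finGroupType.
Implicit Types x y z : gT.
Local Open Scope group_scope.

Lemma coprime_factor_expg x y :
  commute x y -> coprime #[x] #[y] -> exists m, (x * y) ^+ m = x.
Proof.
(* The exponent is 1 modulo the order of x and 0 modulo the order of y. *)
move=> cxy co_xy; exists (chinese #[x] #[y] 1 0).
rewrite expgMn // -(expg_mod_order x) chinese_modl // expg_mod_order expg1.
by rewrite -(expg_mod_order y) chinese_modr // mod0n expg0 mulg1.
Qed.

Lemma commute_coprime_factors x y z :
    commute x y -> coprime #[x] #[y] -> commute z (x * y) ->
  commute z x /\ commute z y.
Proof.
move=> cxy co_xy czxy; split.
  by have [m <-] := coprime_factor_expg cxy co_xy; apply: commuteX.
have [m <-]: exists m, (x * y) ^+ m = y.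
  by rewrite cxy; apply: coprime_factor_expg; rewrite // coprime_sym.
exact: commuteX.
Qed.

Lemma coprime_expg_eq1 x y m : coprime #[x] #[y] -> x ^+ m = y -> y = 1.
Proof.
move=> co_xy def_y; apply/eqP; rewrite -order_eq1.
have/gcdn_idPr <-: #[y] %| #[x] by rewrite -def_y orderXdvd.
exact: co_xy.
Qed.

Lemma power_adj_commute x y : power_adj x y -> commute x y.
Proof.
by case=> _ [m [<-|<-]]; [apply: commuteX | apply/commute_sym/commuteX].
Qed.

End CoprimeFactors.

(** * Subdividing a cycle of the commuting graph *)

Section Subdivision.
Variables (gT : finGroupType) (n : nat) (d : 'I_n -> gT).
Local Open Scope group_scope.

Definition cycle_near (i j : 'I_n) := [|| j == i, j == ordS i | i == ordS j].

Hypothesis n_gt3 : 3 < n.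
Hypothesis commute_near : forall i j, commute (d i) (d j) <-> cycle_near i j.
Hypothesis coprime_next : forall i, coprime #[d i] #[d (ordS i)].

Fact half_ord_proof (i : 'I_(n.*2)) : i./2 < n.
Proof. by rewrite ltn_half_double ltn_ord. Qed.

(** A position on the subdivided cycle is a vertex of the n-cycle if even and an
    edge if odd; giving a vertex two equal ends lets both kinds be treated
    alike. *)
Definition left_end (i : 'I_(n.*2)) : 'I_n := Ordinal (half_ord_proof i).

Definition right_end (i : 'I_(n.*2)) : 'I_n :=
  if odd i then ordS (left_end i) else left_end i.

Definition subdivision (i : 'I_(n.*2)) : gT :=
  if odd i then d (left_end i) * d (ordS (left_end i)) else d (left_end i).

Lemma val_ordS m (i : 'I_m) : ordS i = (if i.+1 == m then 0 else i.+1) :> nat.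
Proof.
have := ltn_ord i; rewrite leq_eqVlt /=.
by case: eqP => [-> _ | _ /= lt_i_m]; rewrite ?modnn ?modn_small.
Qed.

Lemma cycle_near_sym i j : cycle_near i j = cycle_near j i.
Proof. by rewrite /cycle_near eq_sym (orbC (_ == ordS i)). Qed.

(** This is where a triangle (n = 3) has to be excluded: there two steps
    forward are one step back. *)
Lemma cycle_near2 k : ~~ cycle_near k (ordS (ordS k)).
Proof.
have eq_nat (x y : 'I_n) : (x == y) = (x == y :> nat) by [].
rewrite /cycle_near !eq_nat !val_ordS; move: (nat_of_ord k) (ltn_ord k) => m lt_m_n.
case: (eqVneq m.+1 n) => ?; first by do 2!case: ifP => /eqP ?; lia.
case: (eqVneq m.+2 n) => ?; case: ifP => /eqP ?; lia.
Qed.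

Lemma odd_ordS (i : 'I_(n.*2)) : odd (ordS i) = ~~ odd i.
Proof. by rewrite val_ordS; case: eqP => // /(congr1 odd); lia. Qed.

Lemma left_end_ordS i : left_end (ordS i) = right_end i.
Proof.
have val_left k : nat_of_ord (left_end k) = k./2 by [].
apply: ord_inj; rewrite /right_end val_left (fun_if (@nat_of_ord n)).
rewrite !val_ordS val_left.
have := ltn_ord i; case: ifPn => odd_i lt_i;
  repeat case: ifP => /eqP ?; try lia.
Qed.

Lemma eq_ends (i j : 'I_(n.*2)) : odd i = odd j -> left_end i = left_end j -> i = j.
Proof. by move=> eq_o /(congr1 val)/= eq_h; apply: val_inj => /=; lia. Qed.

Lemma near_ends_next i j :
    left_end j = ordS (left_end i) -> cycle_near (left_end i) (right_end j) ->
  ~~ odd j /\ (odd i -> j = ordS i).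
Proof.
rewrite /right_end => eq_l; rewrite eq_l.
case: (boolP (odd j)) => [_ | even_j _]; first by rewrite (negbTE (cycle_near2 _)).
split=> // odd_i; apply: eq_ends; first by rewrite odd_ordS odd_i (negbTE even_j).
by rewrite left_end_ordS /right_end odd_i.
Qed.

(** A clique of the n-cycle is contained in an edge.  So if all the ends of two
    positions are pairwise equal or neighbouring, the positions are equal,
    consecutive, or the two ends of one edge. *)
Lemma near_ends_cases i j :
    cycle_near (left_end i) (left_end j) ->
    cycle_near (left_end i) (right_end j) ->
    cycle_near (left_end j) (right_end i) ->
  [\/ i = j, j = ordS i \/ i = ordS j |
      [/\ ~~ odd i, ~~ odd j & left_end j = ordS (left_end i)
                            \/ left_end i = ordS (left_end j)]].
Proof.
move=> /or3P[] /eqP eq_l near_ij near_ji.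
- case: (eqVneq (odd i) (odd j)) => [eq_o | neq_o].
    by apply: Or31; apply: eq_ends.
  apply: Or32; case: (boolP (odd i)) neq_o => [odd_i | even_i] neq_o.
    right; apply: eq_ends; first by rewrite odd_ordS; lia.
    by rewrite left_end_ordS /right_end; case: (odd j) neq_o.
  left; apply: eq_ends; first by rewrite odd_ordS; lia.
  by rewrite left_end_ordS /right_end (negbTE even_i).
- have [even_j next_i] := near_ends_next eq_l near_ij.
  case: (boolP (odd i)) => [/next_i|]; first by move=> ->; apply: Or32; left.
  by move=> even_i; apply: Or33; split=> //; left.
have [even_i next_j] := near_ends_next eq_l near_ji.
case: (boolP (odd j)) => [/next_j|]; first by move=> ->; apply: Or32; right.
by move=> even_j; apply: Or33; split=> //; right.
Qed.

(** The identity would commute with the element two steps further. *)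
Lemma neq1 i : d i <> 1.
Proof.
move=> d1; have: commute (d i) (d (ordS (ordS i))).
  by rewrite d1; apply: commute_sym; apply: commute1.
by move/commute_near; apply/negP/cycle_near2.
Qed.

Lemma commute_next i : commute (d i) (d (ordS i)).
Proof. by apply/commute_near; rewrite /cycle_near eqxx orbT. Qed.

Lemma commute_subdivision x i :
  commute x (subdivision i) ->
  commute x (d (left_end i)) /\ commute x (d (right_end i)).
Proof.
rewrite /subdivision /right_end; case: (odd i) => //.
by apply: commute_coprime_factors; [apply: commute_next | apply: coprime_next].
Qed.

Lemma next_neq i : d i <> d (ordS i).
Proof.
move=> eq_d; have := coprime_next i; rewrite -eq_d => co_di.
apply: (@neq1 (ordS i)); rewrite -eq_d.
exact: coprime_expg_eq1 co_di (expg1 _).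
Qed.

Lemma next_not_adj i : ~ power_adj (d i) (d (ordS i)).
Proof.
have co := coprime_next i; case=> _ [m [/(coprime_expg_eq1 co)|]].
  exact: neq1.
by rewrite coprime_sym in co; move/(coprime_expg_eq1 co); apply: neq1.
Qed.

Lemma adj_subdivision_next i : power_adj (subdivision i) (subdivision (ordS i)).
Proof.
rewrite /subdivision odd_ordS left_end_ordS /right_end; set k := left_end i.
have cd := commute_next k; have co := coprime_next k.
have [m xm] := coprime_factor_expg cd co.
case: ifP => _ /=; split.
- by move/(canRL (mulgK _)); rewrite mulgV; apply: neq1.
- rewrite coprime_sym in co; have [l xl] := coprime_factor_expg (commute_sym cd) co.
  by exists l; left; rewrite cd.
- by move/(canLR (mulKg _)); rewrite mulVg => /esym; apply: neq1.
by exists m; right.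
Qed.

(** Equality and adjacency both imply commutation, so the same case distinction
    settles injectivity and the absence of chords. *)
Theorem subdivision_induced_cycle :
  @induced_cycle (power_graph gT) _ subdivision.
Proof.
have cases i j : commute (subdivision i) (subdivision j) ->
  [\/ i = j, j = ordS i \/ i = ordS j |
      [/\ ~~ odd i, ~~ odd j & left_end j = ordS (left_end i)
                            \/ left_end i = ordS (left_end j)]].
  move=> /commute_subdivision[/commute_sym/commute_subdivision[cll clr]].
  move=> /commute_sym/commute_subdivision[crl _].
  by apply: near_ends_cases; apply/commute_near => //; apply: commute_sym.
split; first lia.
- move=> i j eq_ij; have: commute (subdivision i) (subdivision j).
    by rewrite eq_ij.
  case/cases=> // [adj_ij | [ei ej eq_d]].
    by case: adj_ij eq_ij => -> => [|/esym] /(proj1 (adj_subdivision_next _)).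
  move: eq_ij; rewrite /subdivision (negbTE ei) (negbTE ej).
  by case: eq_d => -> => [|/esym] /next_neq.
move=> i j; split=> [adj_ij | [->|->]]; first last.
- by apply: power_adj_sym; apply: adj_subdivision_next.
- exact: adj_subdivision_next.
have := power_adj_commute adj_ij; case/cases=> // [eq_ij | [ei ej eq_d]].
  by move: adj_ij; rewrite eq_ij => /power_adj_irrefl.
move: adj_ij; rewrite /= /subdivision (negbTE ei) (negbTE ej).
by case: eq_d => -> => [|/power_adj_sym] /next_not_adj.
Qed.

(** The witness lies two steps beyond the left end, and fails to commute with
    that end. *)
Lemma subdivision_not_central i : exists x, ~ commute (subdivision i) x.
Proof.
exists (d (ordS (ordS (left_end i)))) => /commute_sym/commute_subdivision[].
move=> /commute_near; rewrite cycle_near_sym => near2 _.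
by have /negP := cycle_near2 (left_end i).
Qed.

End Subdivision.

(** * Matrices of determinant 1 as elements of the special linear group *)

Section SpecialLinearElements.
Variables (n : nat) (F : finFieldType).
Implicit Types (M : 'M[F]_n.-1.+1) (x y : subg_of (SL n F)).

(** A total function; its value is meaningful only when M has determinant 1. *)
Definition SL_of M : subg_of (SL n F) :=
  subg (SL n F) (insubd (1%g : {'GL_n[F]}) M).

Lemma SL_ofK M : (\det M = 1)%R -> SL_mx (SL_of M) = M.
Proof.
move=> detM; have GLM: GLval (insubd (1%g : {'GL_n[F]}) M) = M.
  apply: (@insubdK _ _ {'GL_n[F]}); change (M \in unitmx).
  by rewrite unitmxE detM unitr1.
by rewrite /SL_mx subgK // inE GLM; apply/eqP.
Qed.

Lemma SL_mx_inj : injective (@SL_mx n F).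
Proof. by move=> x y /val_inj/val_inj. Qed.

Lemma SL_mxM x y : SL_mx (x * y)%g = (SL_mx x *m SL_mx y)%R.
Proof. exact: GL_ME. Qed.

Lemma SL_mxX x m : SL_mx (x ^+ m)%g = (SL_mx x ^+ m)%R.
Proof.
by elim: m => [|m IHm]; [exact: GL_1E | rewrite expgS exprS SL_mxM IHm].
Qed.

Lemma commute_SL_mx x y :
  commute x y <-> (SL_mx x *m SL_mx y = SL_mx y *m SL_mx x)%R.
Proof.
rewrite -!SL_mxM; split=> [-> // | eq_xy]; exact: SL_mx_inj.
Qed.

Lemma scalar_SL_central x y : is_scalar_mx (SL_mx x) -> commute x y.
Proof.
by case/is_scalar_mxP=> a xa; apply/commute_SL_mx; rewrite xa scalar_mxC.
Qed.

Lemma SL_order_dvdn x m : (SL_mx x ^+ m = 1)%R -> #[x]%g %| m.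
Proof.
move=> xm1; rewrite order_dvdn; apply/eqP/SL_mx_inj; rewrite SL_mxX xm1.
by apply/esym/GL_1E.
Qed.

End SpecialLinearElements.

(** * Scalar matrices perturbed by a matrix of rank one *)

Section RankOnePerturbations.
Local Open Scope ring_scope.
Variables (F : fieldType) (n : nat).
Implicit Types (v : 'cV[F]_n) (g : 'rV[F]_n).

Definition pairing g v : F := (g *m v) 0 0.

(** Transvections are the case a = 1 and g v = 0.  When g v = 1, the dyad v g is
    a projection, and this is the homology acting as a on the kernel of g and as
    a + b on the line of v. *)
Definition rank1 (a b : F) v g : 'M[F]_n := a%:M + b *: (v *m g).

Lemma dyad_mul v g v' g' :
  (v *m g) *m (v' *m g') = pairing g v' *: (v *m g').
Proof.
rewrite mulmxA -(mulmxA v) [g *m v']mx11_scalar.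
by rewrite -(mulmxA v) mul_scalar_mx scalemxAr.
Qed.

(** The matrix determinant lemma, det (1 + v h) = 1 + h v: the two orders of
    multiplication of the same pair of block matrices give block triangular
    matrices with diagonal blocks 1 + v h, 1 and 1, h v + 1. *)
Lemma det_rank1 a b v g :
  a != 0 -> \det (rank1 a b v g) = a ^+ n * (1 + a^-1 * b * pairing g v).
Proof.
move=> a0; have ->: rank1 a b v g = a *: (1%:M + v *m ((a^-1 * b) *: g)).
  by rewrite scalerDr scalemx1 -scalemxAr scalerA mulVKf.
rewrite detZ; congr (_ * _); set h := (_ *: g).
have ->: a^-1 * b * pairing g v = (h *m v) 0 0 by rewrite -scalemxAl mxE.
have e1: block_mx 1%:M v (- h) 1%:M *m block_mx 1%:M 0 h (1%:M : 'M_1)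
       = block_mx (1%:M + v *m h) v 0 1%:M.
  by rewrite mulmx_block !mulmx1 !mul1mx !mulmx0 !add0r addNr.
have e2: block_mx 1%:M 0 h (1%:M : 'M_1) *m block_mx 1%:M v (- h) 1%:M
       = block_mx 1%:M v 0 (h *m v + 1%:M).
  by rewrite mulmx_block !mulmx1 !mul1mx !mul0mx !addr0 addrN.
have := congr1 determinant e1; rewrite det_mulmx mulrC -det_mulmx e2.
by rewrite !det_ublock !det1 mul1r mulr1 => <-; rewrite det_mx11 !mxE addrC.
Qed.

Lemma rank1_mul (a b a' b' : F) v g v' g' :
  rank1 a b v g *m rank1 a' b' v' g' =
    ((a * a')%:M + (a' * b) *: (v *m g) + (a * b') *: (v' *m g'))
      + (b * b') *: (pairing g v' *: (v *m g')).
Proof.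
rewrite /rank1 mulmxDl !mulmxDr -scalar_mxM !mul_scalar_mx mul_mx_scalar.
by rewrite -scalemxAl -scalemxAr dyad_mul !scalerA addrACA !addrA.
Qed.

(** The two products share their scalar part and their first-order terms, so
    everything is decided by the products of the two dyads. *)
Lemma commute_rank1 (a b a' b' : F) v g v' g' :
    b != 0 -> b' != 0 ->
  rank1 a b v g *m rank1 a' b' v' g' = rank1 a' b' v' g' *m rank1 a b v g <->
  pairing g v' *: (v *m g') = pairing g' v *: (v' *m g).
Proof.
move=> b0 b'0; rewrite !rank1_mul (mulrC a' a) (mulrC b' b).
rewrite (addrAC _ ((a * b') *: (v' *m g')) ((a' * b) *: (v *m g))).
split=> [/addrI|-> //].
by apply: scalerI; rewrite mulf_neq0.
Qed.

End RankOnePerturbations.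

Section RankOnePowers.
Local Open Scope ring_scope.
Variables (F : fieldType) (n : nat).
Implicit Types (v : 'cV[F]_n.+1) (g : 'rV[F]_n.+1).

(** The dyad squares to zero. *)
Lemma transvection_expr b v g m :
  pairing g v = 0 -> rank1 1 b v g ^+ m = rank1 1 (b *+ m) v g.
Proof.
move=> gv0; elim: m => [|m IHm].
  by rewrite expr0 /rank1 mulr0n scale0r addr0.
rewrite exprS IHm /rank1 -mulmxE mulmxDl !mulmxDr !mul1mx mulmx1.
rewrite -scalemxAl -scalemxAr dyad_mul gv0 scale0r !scaler0 addr0.
by rewrite -addrA -scalerDl -mulrSr.
Qed.

(** The dyad is a projection, and the matrix has eigenvalues a and b. *)
Lemma homology_expr a b v g m :
    pairing g v = 1 ->
  rank1 a (b - a) v g ^+ m = rank1 (a ^+ m) (b ^+ m - a ^+ m) v g.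
Proof.
move=> gv1; elim: m => [|m IHm].
  by rewrite !expr0 /rank1 subrr scale0r addr0.
rewrite exprS IHm /rank1 -mulmxE mulmxDl !mulmxDr -scalar_mxM -exprS.
rewrite mul_scalar_mx mul_mx_scalar -scalemxAl -scalemxAr dyad_mul gv1 scale1r.
rewrite !scalerA -!addrA; congr (_ + _); rewrite -!scalerDl; congr (_ *: _).
by rewrite !exprS; ring.
Qed.

End RankOnePowers.

(** * The triangle of reference and its cevians *)

Section Hexagon.
Local Open Scope ring_scope.
Variable F : fieldType.
Implicit Types i j : 'I_3.

Definition vertex_pt i : 'cV[F]_3 := delta_mx i 0.
Definition opposite_side i : 'rV[F]_3 := delta_mx 0 i.
Definition center_pt : 'cV[F]_3 := const_mx 1.
(** The equation x_(i+1) = x_(i+2), indices modulo 3, of the line through the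
    vertex P_i and the centre (1 : 1 : 1). *)
Definition cevian i : 'rV[F]_3 := delta_mx 0 (i + 1) - delta_mx 0 (i + 2%:R).

Definition cevian_transvection i := rank1 1 1 (vertex_pt i) (cevian i).
(** The eigenvalue on the centre is a^-2, which makes the determinant 1. *)
Definition central_homology a j := rank1 a (a ^- 2 - a) center_pt (opposite_side j).

Lemma pairing_vertex g i : pairing g (vertex_pt i) = g 0 i.
Proof. by rewrite /pairing -colE mxE. Qed.

Lemma pairing_opposite j v : pairing (opposite_side j) v = v j 0.
Proof. by rewrite /pairing -rowE mxE. Qed.

Lemma pairing_cevian_center i : pairing (cevian i) center_pt = 0.
Proof. by rewrite /pairing mulmxBl -!rowE !mxE subrr. Qed.

Lemma cevian_eq0 i j : (cevian i 0 j == 0) = (i == j).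
Proof.
rewrite !mxE /=; case: i j => [[|[|[|//]]] hi] [[|[|[|//]]] hj] /=;
by rewrite ?subr0 ?sub0r ?subrr ?eqxx ?oppr_eq0 ?oner_eq0.
Qed.

Lemma dyadE (v : 'cV[F]_3) (g : 'rV[F]_3) i j : (v *m g) i j = v i 0 * g 0 j.
Proof. by rewrite mxE big_ord1. Qed.

Lemma commute_cevian_transvections i j :
  cevian_transvection i *m cevian_transvection j =
  cevian_transvection j *m cevian_transvection i <-> i = j.
Proof.
split=> [|-> //]; move/commute_rank1; rewrite oner_neq0 !pairing_vertex.
(* At (i, i) only the dyad on the left contributes if i differs from j: row i of
   the other one vanishes. *)
move/(_ isT isT)/matrixP/(_ i i)/eqP.
have [-> // | ne_ij] := eqVneq i j.
rewrite [X in X == _]mxE [X in _ == X]mxE !dyadE.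
rewrite [vertex_pt i _ _]mxE [vertex_pt j _ _]mxE.
rewrite !eqxx (negbTE ne_ij) mul0r mulr0 mul1r mulf_eq0 !cevian_eq0.
by rewrite (eq_sym j) (negbTE ne_ij).
Qed.

Variable a : F.
Hypothesis a_neq0 : a != 0.
Hypothesis a3_neq1 : a ^+ 3 != 1.

(** The homology is not scalar. *)
Lemma homology_coef_neq0 : a ^- 2 - a != 0.
Proof.
rewrite subr_eq0; apply: contraNneq a3_neq1 => a_def.
by rewrite exprS -{1}a_def mulVf // expf_neq0.
Qed.

Lemma commute_central_homologies i j :
  central_homology a i *m central_homology a j =
  central_homology a j *m central_homology a i <-> i = j.
Proof.
have b0 := homology_coef_neq0.
split=> [|-> //]; move/commute_rank1; rewrite b0 !pairing_opposite.
move/(_ isT isT)/matrixP/(_ i i)/eqP.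
rewrite [X in X == _]mxE [X in _ == X]mxE !dyadE !mxE !eqxx /= !mul1r.
by have [-> // | ne_ij] := eqVneq i j; rewrite eq_sym oner_eq0.
Qed.

(** The centre W of the homology lies on the axis of the transvection, so the
    matrices commute exactly when the centre P_i of the transvection lies on the
    axis L_j of the homology. *)
Lemma commute_transvection_homology i j :
  cevian_transvection i *m central_homology a j =
  central_homology a j *m cevian_transvection i <-> i != j.
Proof.
have b0 := homology_coef_neq0.
rewrite /cevian_transvection /central_homology commute_rank1 ?oner_neq0 //.
rewrite pairing_cevian_center pairing_vertex scale0r mxE eqxx /=.
have [-> | _] := eqVneq i j; last by rewrite scale0r.
(* Column j + 1 is one in which the equation of the cevian H_j is nonzero. *)
rewrite scale1r; split=> // /matrixP/(_ 0 (j + 1))/esym/eqP.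
rewrite dyadE [in X in X * _]mxE mul1r [X in _ == X]mxE cevian_eq0.
by case: j => [[|[|[|//]]] hj].
Qed.

Lemma det_cevian_transvection i : \det (cevian_transvection i) = 1.
Proof.
rewrite det_rank1 ?oner_neq0 // pairing_vertex.
by have /eqP-> : cevian i 0 i == 0; rewrite ?cevian_eq0 // mulr0 addr0 expr1n mulr1.
Qed.

Lemma det_central_homology j : \det (central_homology a j) = 1.
Proof.
rewrite det_rank1 // pairing_opposite mxE mulr1.
by field.
Qed.

Lemma cevian_transvection_expr i p :
  p%:R = 0 :> F -> cevian_transvection i ^+ p = 1.
Proof.
move=> p0; rewrite transvection_expr; last first.
  by rewrite pairing_vertex; apply/eqP; rewrite cevian_eq0.
by rewrite p0 /rank1 scale0r addr0.
Qed.

Lemma central_homology_expr j m : a ^+ m = 1 -> central_homology a j ^+ m = 1.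
Proof.
move=> am1; rewrite homology_expr; last by rewrite pairing_opposite mxE.
by rewrite exprVn exprAC am1 expr1n invr1 subrr /rank1 scale0r addr0.
Qed.

End Hexagon.

(** * A hexagon in SL_3 over a finite field *)

(** A generator of the multiplicative group will do. *)
Lemma finField_cube_neq1 (F : finFieldType) :
  #|F| \notin [:: 2; 4] -> (exists2 a : F, a != 0 & a ^+ 3 != 1)%R.
Proof.
move=> cardF; have /cyclicP[x gen_x] := field_unit_group_cyclic [set: {unit F}]%G.
exists (FinRing.uval x); first by rewrite -unitfE (valP x).
have ox : #[x]%g = #|F|.-1 by rewrite -card_finField_unit orderE -gen_x.
apply: contraNneq cardF => x3; have: #[x]%g %| 3.
  by rewrite order_dvdn; apply/eqP/val_inj; rewrite FinRing.val_unitX; exact: x3.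
rewrite ox; have := finNzRing_gt1 F.
by case: #|F| => [|[|[|[|[|[|?]]]]]].
Qed.

Lemma finField_expr_pred (F : finFieldType) (a : F) :
  (a != 0 -> a ^+ #|F|.-1 = 1)%R.
Proof.
move=> a_neq0; apply: (mulfI a_neq0); rewrite mulr1 -exprS prednK ?expf_card //.
exact: ltnW (finNzRing_gt1 F).
Qed.

Section HexagonInSL3.
Variables (F : finFieldType) (p : nat) (a : F).
Hypothesis a_neq0 : (a != 0)%R.
Hypothesis a3_neq1 : (a ^+ 3 != 1)%R.

Definition mod3 (i : 'I_6) : 'I_3 := Ordinal (ltn_pmod i (isT : 0 < 3)).

(** By the Chinese remainder theorem a position modulo 6 is a parity together
    with an index modulo 3; opposite positions carry a transvection and a
    homology with the same index, the only such pairs that do not commute. *)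
Definition hexagon_mx (i : 'I_6) : 'M[F]_3 :=
  if odd i then central_homology a (mod3 i) else cevian_transvection F (mod3 i).

Definition hexagon (i : 'I_6) : subg_of (SL 3 F) :=
  SL_of (hexagon_mx i : 'M_3.-1.+1).

Lemma SL_mx_hexagon i : SL_mx (hexagon i) = hexagon_mx i.
Proof.
apply: SL_ofK; rewrite /hexagon_mx; case: (odd i).
  exact: det_central_homology.
exact: det_cevian_transvection.
Qed.

Lemma commute_hexagon i j : commute (hexagon i) (hexagon j) <-> cycle_near i j.
Proof.
rewrite commute_SL_mx !SL_mx_hexagon /hexagon_mx.
(* Positions with equal parity are never neighbours; positions with distinct
   parities are neighbours unless they are opposite. *)
have ->: cycle_near i j =
    if odd i == odd j then mod3 i == mod3 j else mod3 i != mod3 j.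
  by case: i j => [[|[|[|[|[|[|//]]]]]] hi] [[|[|[|[|[|[|//]]]]]] hj].
case: (odd i); case: (odd j) => /=.
- by rewrite commute_central_homologies //; split=> [->|/eqP].
- rewrite eq_sym -(commute_transvection_homology a_neq0 a3_neq1).
  by split=> /esym.
- exact: commute_transvection_homology.
by rewrite commute_cevian_transvections; split=> [->|/eqP].
Qed.

Lemma hexagon_order_dvdn i :
    p \in [pchar F]%R -> #[hexagon i]%g %| (if odd i then #|F|.-1 else p).
Proof.
move=> pcharF; apply: SL_order_dvdn; rewrite SL_mx_hexagon /hexagon_mx.
case: (odd i); first exact/central_homology_expr/finField_expr_pred.
by apply: cevian_transvection_expr; apply: pcharf0.
Qed.

End HexagonInSL3.

Theorem lemma3p21 (q : nat) (q_pp : prime_power q) (q_neq : q \notin [:: 2; 4])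
    (F : finFieldType) (cardF : #|F| = q) :
  exists (n : nat) (c : 'I_n -> power_graph (subg_of (SL 3 F))),
    [/\ 3 < n, induced_cycle c & forall i : 'I_n, ~~ is_scalar_mx (SL_mx (c i))].
Proof.
have [p [k [p_pr k_gt0 def_q]]] := q_pp.
have pcharF : p \in [pchar F]%R by apply: (@card_finPcharP F p k); rewrite ?cardF.
have [a a_neq0 a3_neq1] : (exists2 a : F, a != 0 & a ^+ 3 != 1)%R.
  by apply: finField_cube_neq1; rewrite cardF.
have co_pq : coprime p #|F|.-1.
  rewrite -(coprime_pexpl _ _ k_gt0) -def_q -cardF coprimenP //.
  exact: ltnW (finNzRing_gt1 F).
have co_next i : coprime #[hexagon a i]%g #[hexagon a (ordS i)]%g.
  have oi := hexagon_order_dvdn a_neq0 i pcharF.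
  have oSi := hexagon_order_dvdn a_neq0 (ordS i) pcharF.
  apply: (coprime_dvdl oi); apply: (coprime_dvdr oSi).
  have ->: odd (ordS i) = ~~ odd i by case: (i) => [[|[|[|[|[|[|//]]]]]] hi].
  by case: (odd i); rewrite // coprime_sym.
have near := commute_hexagon a_neq0 a3_neq1.
exists 12, (subdivision (hexagon a)); split=> //.
  exact: (@subdivision_induced_cycle _ 6 _ isT near co_next).
move=> i; apply/negP => scal_i.
have [x] := @subdivision_not_central _ 6 _ isT near co_next i; apply.
exact: scalar_SL_central.
Qed.
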